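(* Let $N$ be a positive integer and let $k$ be a field. For any amplitude $a$ (an integer with $1\le a\le N-1$), amplitude cohomology gives a well-defined functor $$(AH)_a^*:\underline{\mathsf{mod}\,\mathcal{L}_N}\to gr(k)$$ from the stable category of $N$-complexes to the category of graded $k$-vector spaces; that is, the functor $M\mapsto(AH)_a^*(M)$ on $N$-complexes factors through the quotient functor onto the stable category.
   Context: An $N$-complex is a $\mathbb{Z}$-graded $k$-vector space $\{{}_iM\}_{i\in\mathbb{Z}}$ together with linear maps $d_i:{}_iM\to{}_{i+1}M$ such that $d_{i+N-1}\circ\dots\circ d_i=0$ for each $i\in\mathbb{Z}$. Morphisms are degree-preserving linear maps commuting with the $d_i$. The category of $N$-complexes is denoted $\mathsf{mod}\,\mathcal{L}_N$ (it is isomorphic to the category of modules, i.e. $k$-linear functors to vector spaces, over the $k$-category $\mathcal{L}_N$ which is the free $k$-category on the quiver with vertices $\mathbb{Z}$ and one arrow $i\to i+1$ for each $i$, modulo the ideal of all morphisms from $i$ to $j$ with $j\ge i+N$). For $1\le a\le N-1$ and $i\in\mathbb{Z}$, the amplitude cohomology is $$(AH)_a^i(M):=\ker(d_{i+a-1}\circ\dots\circ d_i)/\mathrm{im}(d_{i-1}\circ\dots\circ d_{i-N+a}),$$ and $(AH)_a^*(M)$ is the graded vector space with components $(AH)_a^i(M)$; it is a $k$-linear functor of $M$ on $\mathsf{mod}\,\mathcal{L}_N$. The stable category $\underline{\mathsf{mod}\,\mathcal{L}_N}$ is the quotient category $\mathsf{mod}\,\mathcal{L}_N/I$, where $I$ is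 the ideal of morphisms which factor through a projective $N$-complex. $gr(k)$ is the category of graded $k$-vector spaces. *)

(* Defs.v *)
From HB Require Import structures.
From mathcomp Require Import all_boot all_order all_algebra.
From mathcomp Require Import generic_quotient ring_quotient boolp.

Set Implicit Arguments.
Unset Strict Implicit.
Unset Printing Implicit Defensive.

Import GRing.Theory.

Local Open Scope ring_scope.
Local Open Scope quotient_scope.

Lemma linear_ext (k : fieldType) (V W : lmodType k) (f g : {linear V -> W}) :
  f =1 g -> f = g.
Proof.
case: f g => [f [[f1] [f2] ]] [g [[g1] [g2] ]] /= /funext fg.
case: _ / fg in g1 g2 *.
by rewrite (Prop_irrelevance g1 f1) (Prop_irrelevance g2 f2).
Qed.

Section Subspace.
Variables (k : fieldType) (V : lmodType k) (S : submodClosed V).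

Lemma submod_subsemimod : subsemimod_closed S.
Proof.
split; first by split=> [|x y xS yS]; [exact: rpred0 | exact: rpredD].
by move=> c x xS; exact: rpredZ.
Qed.

Record subspace := Subspace { subval : V; subvalP : subval \in S }.

HB.instance Definition _ := [isSub for subval].
HB.instance Definition _ := [Choice of subspace by <:].
HB.instance Definition _ :=
  GRing.SubChoice_isSubLmodule.Build k V _ subspace submod_subsemimod.

End Subspace.

Section QuotientSpace.
Variables (k : fieldType) (V : lmodType k) (S : submodClosed V).

(* A [submodClosed] predicate is not inferred to be [zmodClosed], as
   [Quotient.quot] requires; this alias carries that structure. *)
Definition quot_pred : {pred V} := S.

Fact quot_pred_zmod_closed : zmod_closed quot_pred.
Proof.
split=> [|x y xS yS]; first exact: (rpred0 S).
by rewrite -scaleN1r; apply: (rpredD (S := S)) => //; apply: (rpredZ (s := S)).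
Qed.
HB.instance Definition _ := GRing.isZmodClosed.Build V quot_pred quot_pred_zmod_closed.

Definition quotspace : Type := Quotient.quot quot_pred.

HB.instance Definition _ := Choice.on quotspace.
HB.instance Definition _ := GRing.Zmodule.on quotspace.
HB.instance Definition _ := Quotient.on quotspace.

Definition qpi (x : V) : quotspace := \pi_quotspace x.

Lemma qpiP x y : reflect (qpi x = qpi y) (x - y \in S).
Proof.
have -> : (x - y \in S) = (x - y \in quot_pred) by [].
by rewrite (Quotient.idealrBE quot_pred); apply: eqP.
Qed.

Lemma qpi_repr (u : quotspace) : qpi (repr u) = u.
Proof. exact: reprK. Qed.

Lemma qpi_add x y : qpi (x + y) = qpi x + qpi y.
Proof. exact: (raddfD \pi_(Quotient.quot quot_pred)). Qed.

Definition qscale (c : k) (u : quotspace) : quotspace := qpi (c *: repr u).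

Lemma qpi_scale c x : qpi (c *: x) = qscale c (qpi x).
Proof.
apply/qpiP; rewrite -scalerBr rpredZ //.
by apply/qpiP; rewrite qpi_repr.
Qed.

Fact qscaleA a b u : qscale a (qscale b u) = qscale (a * b) u.
Proof. by rewrite -(qpi_repr u) -!qpi_scale scalerA. Qed.

Fact qscale1 : left_id 1 qscale.
Proof. by move=> u; rewrite -(qpi_repr u) -qpi_scale scale1r. Qed.

Fact qscaleDr : right_distributive qscale +%R.
Proof.
move=> c u v; rewrite -(qpi_repr u) -(qpi_repr v).
by rewrite -qpi_add -!qpi_scale scalerDr qpi_add.
Qed.

Fact qscaleDl u : {morph qscale^~ u : a b / a + b}.
Proof.
by move=> a b; rewrite -(qpi_repr u) -!qpi_scale scalerDl qpi_add.
Qed.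

HB.instance Definition _ := GRing.Zmodule_isLmodule.Build k quotspace
  qscaleA qscale1 qscaleDr qscaleDl.

Fact qpi_is_linear : linear qpi.
Proof. by move=> c x y; rewrite qpi_add qpi_scale. Qed.
HB.instance Definition _ :=
  GRing.isLinear.Build k V quotspace _ qpi qpi_is_linear.

End QuotientSpace.

Section InducedMaps.
Variables (k : fieldType) (V W : lmodType k).
Variables (S : submodClosed V) (T : submodClosed W) (f : {linear V -> W}).
Hypothesis fST : forall x, x \in S -> f x \in T.

Definition sub_map (x : subspace S) : subspace T := Subspace (fST (valP x)).

Fact sub_map_is_linear : linear sub_map.
Proof. by move=> c x y; apply: val_inj; rewrite /= !linearP. Qed.
HB.instance Definition _ := GRing.isLinear.Build k (subspace S) (subspace T) _
  sub_map sub_map_is_linear.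

Definition quot_fun (u : quotspace S) : quotspace T := qpi T (f (repr u)).

Fact quot_funE x : quot_fun (qpi S x) = qpi T (f x).
Proof.
by apply/qpiP; rewrite -linearB; apply: fST; apply/qpiP; rewrite qpi_repr.
Qed.

Fact quot_fun_is_linear : linear quot_fun.
Proof.
move=> c u v; rewrite -(qpi_repr u) -(qpi_repr v) -linearP !quot_funE.
by rewrite !linearP.
Qed.

Definition quot_map : {linear quotspace S -> quotspace T} :=
  HB.pack quot_fun
    (GRing.isLinear.Build k (quotspace S) (quotspace T) _ quot_fun
       quot_fun_is_linear).

Lemma quot_mapE x : quot_map (qpi S x) = qpi T (f x).
Proof. exact: quot_funE. Qed.

End InducedMaps.

Record kcat (k : fieldType) := KCat {
  obj :> Type;
  hom : obj -> obj -> lmodType k;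
  idm : forall x, hom x x;
  kcomp : forall x y z, hom y z -> hom x y -> hom x z;
  compA : forall x y z t (h : hom z t) (g : hom y z) (f : hom x y),
    kcomp h (kcomp g f) = kcomp (kcomp h g) f;
  comp1m : forall x y (f : hom x y), kcomp (idm y) f = f;
  compm1 : forall x y (f : hom x y), kcomp f (idm x) = f;
  comp_linl : forall x y z (f : hom x y), linear (fun g : hom y z => kcomp g f);
  comp_linr : forall x y z (g : hom y z), linear (fun f : hom x y => kcomp g f)
}.

Arguments hom {k} C _ _ : rename.
Arguments idm {k C} x : rename.
Arguments kcomp {k C x y z} g f : rename.

Notation "g \oc f" := (kcomp g f) (at level 40, left associativity).

Record kfunctor (k : fieldType) (C D : kcat k) := KFunctor {
  fobj :> C -> D;
  fmap : forall x y, {linear hom C x y -> hom D (fobj x) (fobj y)};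
  fmap1 : forall x, fmap x x (idm x) = idm (fobj x);
  fmapM : forall x y z (g : hom C y z) (f : hom C x y),
    fmap x z (g \oc f) = fmap y z g \oc fmap x y f
}.

Arguments fmap {k C D} F {x y} : rename.

Section Composition.
Variables (k : fieldType) (C D E : kcat k) (G : kfunctor D E) (F : kfunctor C D).

Definition fcomp_map x y : {linear hom C x y -> hom E (G (F x)) (G (F y))} :=
  fmap G \o fmap F.

Fact fcomp_map1 x : fcomp_map x x (idm x) = idm (G (F x)).
Proof. by rewrite /= !fmap1. Qed.

Fact fcomp_mapM x y z (g : hom C y z) (f : hom C x y) :
  fcomp_map x z (g \oc f) = fcomp_map y z g \oc fcomp_map x y f.
Proof. by rewrite /= !fmapM. Qed.

Definition fcomp : kfunctor C E := KFunctor fcomp_map1 fcomp_mapM.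

End Composition.

Section CategoryTheory.
Variables (k : fieldType) (C : kcat k).

Lemma compDl x y z (g g' : hom C y z) (f : hom C x y) :
  (g + g') \oc f = g \oc f + g' \oc f.
Proof. by have := comp_linl f 1 g g'; rewrite !scale1r. Qed.

Lemma compDr x y z (g : hom C y z) (f f' : hom C x y) :
  g \oc (f + f') = g \oc f + g \oc f'.
Proof. by have := comp_linr g 1 f f'; rewrite !scale1r. Qed.

Lemma comp0m x y z (f : hom C x y) : (0 : hom C y z) \oc f = 0.
Proof.
apply: (addrI ((0 : hom C y z) \oc f)).
by rewrite addr0 -compDl addr0.
Qed.

Lemma compm0 x y z (g : hom C y z) : g \oc (0 : hom C x y) = 0.
Proof.
apply: (addrI (g \oc (0 : hom C x y))).
by rewrite addr0 -compDr addr0.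
Qed.

Lemma compZl x y z c (g : hom C y z) (f : hom C x y) :
  (c *: g) \oc f = c *: (g \oc f).
Proof. by have := comp_linl f c g 0; rewrite comp0m !addr0. Qed.

Lemma compZr x y z c (g : hom C y z) (f : hom C x y) :
  g \oc (c *: f) = c *: (g \oc f).
Proof. by have := comp_linr g c f 0; rewrite compm0 !addr0. Qed.

Definition epi x y (g : hom C x y) :=
  forall z (u v : hom C y z), u \oc g = v \oc g -> u = v.

Definition projective (p : C) :=
  forall x y (g : hom C x y) (f : hom C p y),
    epi g -> exists h : hom C p x, g \oc h = f.

Definition is_zero (z : C) := idm z = 0.

Definition is_biproduct (x y b : C) :=
  exists (i1 : hom C x b) (i2 : hom C y b) (p1 : hom C b x) (p2 : hom C b y),
    [/\ p1 \oc i1 = idm x, p2 \oc i2 = idm y, p1 \oc i2 = 0, p2 \oc i1 = 0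
      & i1 \oc p1 + i2 \oc p2 = idm b].

Definition additive_cat :=
  (exists z, is_zero z) /\ forall x y, exists b, is_biproduct x y b.

Lemma projective_zero z : is_zero z -> projective z.
Proof.
move=> z0 x y g f _; exists 0.
by rewrite compm0 -(compm1 f) z0 compm0.
Qed.

Lemma projective_biproduct x y b :
  is_biproduct x y b -> projective x -> projective y -> projective b.
Proof.
move=> [i1 [i2 [p1 [p2 [_ _ _ _ ib]]]]] Px Py u v g f epig.
have [h1 h1E] := Px _ _ g (f \oc i1) epig.
have [h2 h2E] := Py _ _ g (f \oc i2) epig.
exists (h1 \oc p1 + h2 \oc p2).
by rewrite compDr !compA h1E h2E -!compA -compDr ib compm1.
Qed.

End CategoryTheory.

Record kideal (k : fieldType) (C : kcat k) := KIdeal {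
  ihom :> forall x y, submodClosed (hom C x y);
  ihom_compl : forall x y z (g : hom C y z) (f : hom C x y),
    f \in ihom x y -> g \oc f \in ihom x z;
  ihom_compr : forall x y z (g : hom C y z) (f : hom C x y),
    g \in ihom y z -> g \oc f \in ihom x z
}.

Section QuotientCategory.
Variables (k : fieldType) (C : kcat k) (I : kideal C).

Definition qhom (x y : C) : lmodType k := quotspace (I x y).

Definition qcls x y (f : hom C x y) : qhom x y := qpi (I x y) f.

Definition qcomp x y z (g : qhom y z) (f : qhom x y) : qhom x z :=
  qcls (repr g \oc repr f).

Lemma qcompE x y z (g : hom C y z) (f : hom C x y) :
  qcomp (qcls g) (qcls f) = qcls (g \oc f).
Proof.
apply/qpiP; set g' := repr _; set f' := repr _.
have -> : g' \oc f' - g \oc f = (g' - g) \oc f' + g \oc (f' - f).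
  by rewrite compDl compDr -!scaleN1r compZl compZr !scaleN1r subrKA.
apply: rpredD; [apply: ihom_compr | apply: ihom_compl].
  by apply/qpiP; exact: qpi_repr.
by apply/qpiP; exact: qpi_repr.
Qed.

Lemma qcls_repr x y (f : qhom x y) : qcls (repr f) = f.
Proof. exact: qpi_repr. Qed.

Fact qcompA x y z t (h : qhom z t) (g : qhom y z) (f : qhom x y) :
  qcomp h (qcomp g f) = qcomp (qcomp h g) f.
Proof.
rewrite -(qcls_repr h) -(qcls_repr g) -(qcls_repr f).
by rewrite !qcompE compA.
Qed.

Fact qcomp1m x y (f : qhom x y) : qcomp (qcls (idm y)) f = f.
Proof. by rewrite -(qcls_repr f) qcompE comp1m. Qed.

Fact qcompm1 x y (f : qhom x y) : qcomp f (qcls (idm x)) = f.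
Proof. by rewrite -(qcls_repr f) qcompE compm1. Qed.

Fact qcls_is_linear x y : linear (@qcls x y).
Proof. exact: qpi_is_linear. Qed.
HB.instance Definition _ x y :=
  GRing.isLinear.Build k (hom C x y) (qhom x y) _ (@qcls x y)
    (@qcls_is_linear x y).

Fact qcomp_linl x y z (f : qhom x y) : linear (fun g : qhom y z => qcomp g f).
Proof.
move=> c g g'; rewrite -(qcls_repr f) -(qcls_repr g) -(qcls_repr g').
by rewrite -linearP !qcompE comp_linl linearP.
Qed.

Fact qcomp_linr x y z (g : qhom y z) : linear (fun f : qhom x y => qcomp g f).
Proof.
move=> c f f'; rewrite -(qcls_repr g) -(qcls_repr f) -(qcls_repr f').
by rewrite -linearP !qcompE comp_linr linearP.
Qed.

Definition quot_cat : kcat k := KCat qcompA qcomp1m qcompm1 qcomp_linl qcomp_linr.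

Definition quot_fmap (x y : C) : {linear hom C x y -> hom quot_cat x y} :=
  @qcls x y.

Fact quot_fmap1 (x : C) : quot_fmap x x (idm x) = idm (x : quot_cat).
Proof. by []. Qed.

Fact quot_fmapM (x y z : C) (g : hom C y z) (f : hom C x y) :
  quot_fmap x z (g \oc f) = quot_fmap y z g \oc quot_fmap x y f.
Proof. by rewrite /= qcompE. Qed.

Definition quot_functor : kfunctor C quot_cat := KFunctor quot_fmap1 quot_fmapM.

End QuotientCategory.

Section Stable.
Variables (k : fieldType) (C : kcat k) (addC : additive_cat C).

Definition factors_proj (x y : C) : {pred hom C x y} := fun f =>
  `[< exists (p : C) (h : hom C p y) (g : hom C x p),
        projective p /\ f = h \oc g >].

Fact factors_proj_submod (x y : C) : subsemimod_closed (@factors_proj x y).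
Proof.
split; [split|].
- have [z z0] := addC.1; apply/asboolP; exists z, 0, 0.
  by split; [exact: projective_zero | rewrite comp0m].
- move=> _ _ /asboolP[p [h [g [Pp ->]]]] /asboolP[p' [h' [g' [Pp' ->]]]].
  have [b bP] := addC.2 p p'; have Pb := projective_biproduct bP Pp Pp'.
  have [i1 [i2 [p1 [p2 [e1 e2 e3 e4 _]]]]] := bP.
  apply/asboolP; exists b, (h \oc p1 + h' \oc p2), (i1 \oc g + i2 \oc g').
  split=> //; rewrite compDl !compDr !compA.
  rewrite -(compA h p1 i1) -(compA h p1 i2) -(compA h' p2 i1) -(compA h' p2 i2).
  by rewrite e1 e2 e3 e4 !compm1 !compm0 !comp0m addr0 add0r.
- move=> c _ /asboolP[p [h [g [Pp ->]]]]; apply/asboolP.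
  by exists p, h, (c *: g); rewrite compZr.
Qed.
HB.instance Definition _ (x y : C) :=
  GRing.isSubmodClosed.Build k (hom C x y) (@factors_proj x y)
    (@factors_proj_submod x y).

Fact factors_proj_compl (x y z : C) (g : hom C y z) (f : hom C x y) :
  f \in @factors_proj x y -> g \oc f \in @factors_proj x z.
Proof.
move=> /asboolP[p [h [f' [Pp ->]]]]; apply/asboolP.
by exists p, (g \oc h), f'; rewrite compA.
Qed.

Fact factors_proj_compr (x y z : C) (g : hom C y z) (f : hom C x y) :
  g \in @factors_proj y z -> g \oc f \in @factors_proj x z.
Proof.
move=> /asboolP[p [h [g' [Pp ->]]]]; apply/asboolP.
by exists p, h, (g' \oc f); rewrite compA.
Qed.

Definition proj_ideal : kideal C :=
  @KIdeal k C (fun x y => @factors_proj x y) factors_proj_compl factors_proj_compr.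

(* Same objects as [C]; morphisms of [C] modulo those that factor through a
   projective object. *)
Definition stable_cat : kcat k := quot_cat proj_ideal.

Definition stable_functor : kfunctor C stable_cat := quot_functor proj_ideal.

End Stable.

Section Graded.
Variable k : fieldType.

Definition grobj := int -> lmodType k.

Record grhom (V W : grobj) := GrHom { grmap :> forall i, {linear V i -> W i} }.

Lemma grhom_ext (V W : grobj) (f g : grhom V W) :
  (forall i x, f i x = g i x) -> f = g.
Proof.
case: f g => f [g] /= fg; congr GrHom.
by apply: functional_extensionality_dep => i; apply: linear_ext; exact: fg.
Qed.

Section GrHomSpace.
Variables V W : grobj.

HB.instance Definition _ := gen_eqMixin (grhom V W).
HB.instance Definition _ := gen_choiceMixin (grhom V W).

Definition grhom0 : grhom V W := GrHom (fun i => \0).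
Definition grhom_opp (f : grhom V W) : grhom V W := GrHom (fun i => \- (f i)).
Definition grhom_add (f g : grhom V W) : grhom V W :=
  GrHom (fun i => f i \+ g i).
Definition grhom_scale (c : k) (f : grhom V W) : grhom V W :=
  GrHom (fun i => c \*: f i).

Fact grhom_addA : associative grhom_add.
Proof. by move=> f g h; apply: grhom_ext => i x /=; rewrite addrA. Qed.
Fact grhom_addC : commutative grhom_add.
Proof. by move=> f g; apply: grhom_ext => i x /=; rewrite addrC. Qed.
Fact grhom_add0 : left_id grhom0 grhom_add.
Proof. by move=> f; apply: grhom_ext => i x /=; rewrite add0r. Qed.
Fact grhom_addN : left_inverse grhom0 grhom_opp grhom_add.
Proof. by move=> f; apply: grhom_ext => i x /=; rewrite addNr. Qed.
HB.instance Definition _ := GRing.isZmodule.Build (grhom V W)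
  grhom_addA grhom_addC grhom_add0 grhom_addN.

Fact grhom_scaleA a b f : grhom_scale a (grhom_scale b f) = grhom_scale (a * b) f.
Proof. by apply: grhom_ext => i x /=; rewrite scalerA. Qed.
Fact grhom_scale1 : left_id 1 grhom_scale.
Proof. by move=> f; apply: grhom_ext => i x /=; rewrite scale1r. Qed.
Fact grhom_scaleDr : right_distributive grhom_scale +%R.
Proof. by move=> c f g; apply: grhom_ext => i x /=; rewrite scalerDr. Qed.
Fact grhom_scaleDl f : {morph grhom_scale^~ f : a b / a + b}.
Proof. by move=> a b; apply: grhom_ext => i x /=; rewrite scalerDl. Qed.
HB.instance Definition _ := GRing.Zmodule_isLmodule.Build k (grhom V W)
  grhom_scaleA grhom_scale1 grhom_scaleDr grhom_scaleDl.

End GrHomSpace.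

Definition grid (V : grobj) : grhom V V := GrHom (fun i => idfun).

Definition grcomp (U V W : grobj) (g : grhom V W) (f : grhom U V) : grhom U W :=
  GrHom (fun i => g i \o f i).

Fact grcompA U V W X (h : grhom W X) (g : grhom V W) (f : grhom U V) :
  grcomp h (grcomp g f) = grcomp (grcomp h g) f.
Proof. exact: grhom_ext. Qed.
Fact grcomp1m V W (f : grhom V W) : grcomp (grid W) f = f.
Proof. exact: grhom_ext. Qed.
Fact grcompm1 V W (f : grhom V W) : grcomp f (grid V) = f.
Proof. exact: grhom_ext. Qed.
Fact grcomp_linl U V W (f : grhom U V) :
  linear (fun g : grhom V W => grcomp g f).
Proof. by move=> c g g'; apply: grhom_ext. Qed.
Fact grcomp_linr U V W (g : grhom V W) :
  linear (fun f : grhom U V => grcomp g f).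
Proof. by move=> c f f'; apply: grhom_ext => i x /=; rewrite linearP. Qed.

Definition gr : kcat k :=
  @KCat k grobj grhom grid grcomp grcompA grcomp1m grcompm1
    grcomp_linl grcomp_linr.

Definition shift (n : nat) (i : int) : int := iter n (fun j => j + 1) i.

Lemma shiftE n i : shift n i = i + n%:Z.
Proof.
elim: n => [|n IHn]; first by rewrite addr0.
by rewrite /shift iterS -/(shift n i) IHn intS (addrC 1) addrA.
Qed.

Lemma shiftB n i : shift n (i - n%:Z) = i.
Proof. by rewrite shiftE subrK. Qed.

(* [dpow d n i] is the composite [d (i + n - 1) \o ... \o d i]. *)
Fixpoint dpow (V : grobj) (d : forall i, {linear V i -> V (i + 1)})
    (n : nat) (i : int) : V i -> V (shift n i) :=
  if n is n'.+1 return V i -> V (shift n i)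
  then fun x => d (shift n' i) (dpow d n' x) else id.

Record ncomplex (N : nat) := NComplex {
  ncobj :> int -> lmodType k;
  ncd : forall i, {linear ncobj i -> ncobj (i + 1)};
  ncdN : forall i (x : ncobj i), dpow ncd N x = 0
}.

Arguments ncd {N} M i : rename.

Section NComplexes.
Variable N : nat.
Implicit Types L M W : ncomplex N.

Definition is_chain M W : {pred grhom M W} := fun f =>
  `[< forall i (x : M i), f (i + 1) (ncd M i x) = ncd W i (f i x) >].

Fact is_chain_submod M W : subsemimod_closed (@is_chain M W).
Proof.
split; [split|].
- by apply/asboolP => i x /=; rewrite linear0.
- move=> f g /asboolP cf /asboolP cg; apply/asboolP => i x /=.
  by rewrite cf cg linearD.
- by move=> c f /asboolP cf; apply/asboolP => i x /=; rewrite cf linearZ.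
Qed.
HB.instance Definition _ M W :=
  GRing.isSubmodClosed.Build k (grhom M W) (@is_chain M W) (@is_chain_submod M W).

Definition nchom M W : lmodType k := subspace (@is_chain M W).

Lemma nchomP M W (f : nchom M W) i (x : M i) :
  val f (i + 1) (ncd M i x) = ncd W i (val f i x).
Proof. by have /asboolP := valP f. Qed.

Fact ncid_chain M : grid M \in @is_chain M M.
Proof. exact/asboolP. Qed.

Definition ncid M : nchom M M := Subspace (ncid_chain M).

Fact nccomp_chain L M W (g : nchom M W) (f : nchom L M) :
  grcomp (val g) (val f) \in @is_chain L W.
Proof. by apply/asboolP => i x /=; rewrite !nchomP. Qed.

Definition nccomp L M W (g : nchom M W) (f : nchom L M) : nchom L W :=
  Subspace (nccomp_chain g f).

Fact nccompA L M W X (h : nchom W X) (g : nchom M W) (f : nchom L M) :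
  nccomp h (nccomp g f) = nccomp (nccomp h g) f.
Proof. by apply: val_inj; exact: grcompA. Qed.
Fact nccomp1m M W (f : nchom M W) : nccomp (ncid W) f = f.
Proof. by apply: val_inj; exact: grcomp1m. Qed.
Fact nccompm1 M W (f : nchom M W) : nccomp f (ncid M) = f.
Proof. by apply: val_inj; exact: grcompm1. Qed.
Fact nccomp_linl L M W (f : nchom L M) :
  linear (fun g : nchom M W => nccomp g f).
Proof. by move=> c g g'; apply: val_inj; exact: grcomp_linl. Qed.
Fact nccomp_linr L M W (g : nchom M W) :
  linear (fun f : nchom L M => nccomp g f).
Proof. by move=> c f f'; apply: val_inj; exact: grcomp_linr. Qed.

Definition modL : kcat k :=
  @KCat k (ncomplex N) nchom ncid nccomp nccompA nccomp1m nccompm1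
    nccomp_linl nccomp_linr.

Lemma dpow_is_linear (V : grobj) (d : forall i, {linear V i -> V (i + 1)}) n i :
  linear (@dpow V d n i).
Proof. by move=> c; elim: n => [|n IHn] x y //=; rewrite IHn linearP. Qed.
HB.instance Definition _ (V : grobj)
    (d : forall i, {linear V i -> V (i + 1)}) n i :=
  GRing.isLinear.Build k (V i) (V (shift n i)) _ (@dpow V d n i)
    (@dpow_is_linear V d n i).

Lemma dpow_chain M W (f : nchom M W) n i (x : M i) :
  val f (shift n i) (dpow (ncd M) n x) = dpow (ncd W) n (val f i x).
Proof. by elim: n => //= n IHn; rewrite nchomP IHn. Qed.

Definition nc0_obj : grobj := fun=> 'rV[k]_0.

Definition nc0_d i : {linear nc0_obj i -> nc0_obj (i + 1)} := \0.

Fact nc0_dN i (x : nc0_obj i) : dpow nc0_d N x = 0.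
Proof. exact: (@thinmx0 k 1). Qed.

Definition nc0 : ncomplex N := NComplex nc0_dN.

Section DirectSum.
Variables M W : ncomplex N.

Definition ncsum_obj : grobj := fun i => (M i * W i)%type.

Definition ncsum_df i (x : ncsum_obj i) : ncsum_obj (i + 1) :=
  (ncd M i x.1, ncd W i x.2).

Fact ncsum_df_is_linear i : linear (@ncsum_df i).
Proof. by move=> c x y; rewrite /ncsum_df /= !linearP. Qed.
HB.instance Definition _ i :=
  GRing.isLinear.Build k (ncsum_obj i) (ncsum_obj (i + 1)) _ (@ncsum_df i)
    (@ncsum_df_is_linear i).

Definition ncsum_d i : {linear ncsum_obj i -> ncsum_obj (i + 1)} := @ncsum_df i.

Fact ncsum_dN i (x : ncsum_obj i) : dpow ncsum_d N x = 0.
Proof.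
have dE n : dpow ncsum_d n x = (dpow (ncd M) n x.1, dpow (ncd W) n x.2).
  by elim: n => [|n /= ->] //; case: x.
by rewrite dE !ncdN.
Qed.

Definition ncsum : ncomplex N := NComplex ncsum_dN.

Definition inlf i (x : M i) : ncsum i := (x, 0).
Definition inrf i (x : W i) : ncsum i := (0, x).
Definition fstf i (x : ncsum i) : M i := x.1.
Definition sndf i (x : ncsum i) : W i := x.2.

Fact inlf_is_linear i : linear (@inlf i).
Proof. by move=> c x y; congr pair; rewrite /= scaler0 addr0. Qed.
HB.instance Definition _ i :=
  GRing.isLinear.Build k (M i) (ncsum i) _ (@inlf i) (@inlf_is_linear i).
Fact inrf_is_linear i : linear (@inrf i).
Proof. by move=> c x y; congr pair; rewrite /= scaler0 addr0. Qed.
HB.instance Definition _ i :=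
  GRing.isLinear.Build k (W i) (ncsum i) _ (@inrf i) (@inrf_is_linear i).
Fact fstf_is_linear i : linear (@fstf i).
Proof. by []. Qed.
HB.instance Definition _ i :=
  GRing.isLinear.Build k (ncsum i) (M i) _ (@fstf i) (@fstf_is_linear i).
Fact sndf_is_linear i : linear (@sndf i).
Proof. by []. Qed.
HB.instance Definition _ i :=
  GRing.isLinear.Build k (ncsum i) (W i) _ (@sndf i) (@sndf_is_linear i).

Definition inl_gr : grhom M ncsum := GrHom (fun i => @inlf i).
Definition inr_gr : grhom W ncsum := GrHom (fun i => @inrf i).
Definition fst_gr : grhom ncsum M := GrHom (fun i => @fstf i).
Definition snd_gr : grhom ncsum W := GrHom (fun i => @sndf i).

Fact inl_chain : inl_gr \in @is_chain M ncsum.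
Proof. by apply/asboolP => i x; congr pair; rewrite /= linear0. Qed.
Fact inr_chain : inr_gr \in @is_chain W ncsum.
Proof. by apply/asboolP => i x; congr pair; rewrite /= linear0. Qed.
Fact fst_chain : fst_gr \in @is_chain ncsum M.
Proof. exact/asboolP. Qed.
Fact snd_chain : snd_gr \in @is_chain ncsum W.
Proof. exact/asboolP. Qed.

Lemma ncsum_biproduct : @is_biproduct k modL M W ncsum.
Proof.
exists (Subspace inl_chain), (Subspace inr_chain).
exists (Subspace fst_chain), (Subspace snd_chain).
split; apply: val_inj; apply: grhom_ext => i x //=.
by case: x => x y; congr pair; rewrite /= (addr0, add0r).
Qed.

End DirectSum.

Lemma modL_additive : additive_cat modL.
Proof.
split; last by move=> M W; exists (ncsum M W); exact: ncsum_biproduct.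
exists nc0; apply: val_inj; apply: grhom_ext => i x.
by rewrite [LHS](@thinmx0 k 1) [RHS](@thinmx0 k 1).
Qed.

Definition stable_modL : kcat k := stable_cat modL_additive.

Definition to_stable : kfunctor modL stable_modL := stable_functor modL_additive.

Definition ker_pow M (n : nat) (i : int) : {pred M i} :=
  fun x => dpow (ncd M) n x == 0.

Fact ker_pow_submod M n i : subsemimod_closed (@ker_pow M n i).
Proof.
split; [split|].
- by apply/eqP; rewrite linear0.
- by move=> x y /eqP x0 /eqP y0; apply/eqP; rewrite linearD /= x0 y0 addr0.
- by move=> c x /eqP x0; apply/eqP; rewrite linearZ /= x0 scaler0.
Qed.
HB.instance Definition _ M n i :=
  GRing.isSubmodClosed.Build k (M i) (@ker_pow M n i) (@ker_pow_submod M n i).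

(* [im_pow M n i] is the image of [d (i - 1) \o ... \o d (i - n)]; the cast
   identifies the degree [shift n (i - n)] of its codomain with [i]. *)
Definition im_pow M (n : nat) (i : int) : {pred M i} := fun x =>
  `[< exists y : M (i - n%:Z), ecast j (M j) (shiftB n i) (dpow (ncd M) n y) = x >].

Fact ecast_linear M i j (e : i = j) : linear (fun x : M i => ecast j (M j) e x).
Proof. by case: _ / e. Qed.

Fact ecast0 M i j (e : i = j) : ecast j (M j) e (0 : M i) = 0.
Proof. by case: _ / e. Qed.

Fact ecast_grhom (M W : grobj) (f : grhom M W) i j (e : i = j) (x : M i) :
  f j (ecast j (M j) e x) = ecast j (W j) e (f i x).
Proof. by case: _ / e. Qed.

Fact im_pow_submod M n i : subsemimod_closed (@im_pow M n i).
Proof.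
have lin c (y y' : M (i - n%:Z)) :
    ecast j (M j) (shiftB n i) (dpow (ncd M) n (c *: y + y'))
    = c *: ecast j (M j) (shiftB n i) (dpow (ncd M) n y)
      + ecast j (M j) (shiftB n i) (dpow (ncd M) n y').
  by rewrite linearP ecast_linear.
have im0 : 0 \in @im_pow M n i.
  by apply/asboolP; exists 0; rewrite linear0 ecast0.
split; [split=> //|].
- move=> _ _ /asboolP[y <-] /asboolP[y' <-]; apply/asboolP.
  by exists (1 *: y + y'); rewrite lin scale1r.
- move=> c _ /asboolP[y <-]; have /asboolP[y' y'0] := im0; apply/asboolP.
  by exists (c *: y + y'); rewrite lin y'0 addr0.
Qed.
HB.instance Definition _ M n i :=
  GRing.isSubmodClosed.Build k (M i) (@im_pow M n i) (@im_pow_submod M n i).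

Variable a : nat.

Definition cycles M (i : int) : lmodType k := subspace (@ker_pow M a i).

(* For [a <= N], the image of the [(N - a)]-fold differential lies in [cycles],
   since [N] consecutive differentials compose to zero; [bound] is that image,
   seen as a subspace of [cycles]. *)
Definition bound M (i : int) : {pred cycles M i} :=
  fun x => val x \in @im_pow M (N - a) i.

Fact bound_submod M i : subsemimod_closed (@bound M i).
Proof.
split; [split|].
- exact: (rpred0 (@im_pow M (N - a) i)).
- by move=> x y; exact: (@rpredD _ (@im_pow M (N - a) i)).
- by move=> c x; exact: (@rpredZ _ _ (@im_pow M (N - a) i)).
Qed.
HB.instance Definition _ M i :=
  GRing.isSubmodClosed.Build k (cycles M i) (@bound M i) (@bound_submod M i).

Definition amp_coh M : gr := fun i => quotspace (@bound M i).

Section Functoriality.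
Variables (M W : ncomplex N) (f : nchom M W) (i : int).

Fact ker_pow_map x : x \in @ker_pow M a i -> val f i x \in @ker_pow W a i.
Proof. by move=> /eqP x0; apply/eqP; rewrite -dpow_chain x0 linear0. Qed.

Definition cycles_map : {linear cycles M i -> cycles W i} := sub_map ker_pow_map.

Fact bound_map x : x \in @bound M i -> cycles_map x \in @bound W i.
Proof.
move=> /asboolP[y yE]; apply/asboolP; exists (val f _ y).
by rewrite -dpow_chain -ecast_grhom yE.
Qed.

Definition amp_coh_map_deg : {linear amp_coh M i -> amp_coh W i} :=
  quot_map bound_map.

End Functoriality.

Definition amp_coh_hom M W (f : nchom M W) : hom gr (amp_coh M) (amp_coh W) :=
  GrHom (fun i => amp_coh_map_deg f i).

Lemma amp_coh_homE M W (f : nchom M W) i (x : cycles M i) :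
  amp_coh_hom f i (qpi _ x) = qpi _ (cycles_map f i x).
Proof. exact: quot_mapE. Qed.

Lemma amp_coh_hom_ext M W (g h : hom gr (amp_coh M) (amp_coh W)) :
  (forall i (x : cycles M i), g i (qpi _ x) = h i (qpi _ x)) -> g = h.
Proof. by move=> gh; apply: grhom_ext => i u; rewrite -(qpi_repr u). Qed.

Fact amp_coh_hom_is_linear M W : linear (@amp_coh_hom M W).
Proof.
move=> c f g; apply: amp_coh_hom_ext => i x.
transitivity (c *: amp_coh_hom f i (qpi _ x) + amp_coh_hom g i (qpi _ x)) => //.
rewrite !amp_coh_homE -[RHS]qpi_is_linear; congr qpi.
exact: val_inj.
Qed.
HB.instance Definition _ M W :=
  GRing.isLinear.Build k (nchom M W) (hom gr (amp_coh M) (amp_coh W)) _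
    (@amp_coh_hom M W) (@amp_coh_hom_is_linear M W).

Definition amp_coh_fmap (M W : modL) :
  {linear hom modL M W -> hom gr (amp_coh M) (amp_coh W)} := @amp_coh_hom M W.

Fact amp_coh_fmap1 (M : modL) : amp_coh_fmap M M (idm M) = idm (amp_coh M).
Proof.
apply: amp_coh_hom_ext => i x; rewrite amp_coh_homE; congr qpi.
exact: val_inj.
Qed.

Fact amp_coh_fmapM (L M W : modL) (g : hom modL M W) (f : hom modL L M) :
  amp_coh_fmap L W (g \oc f) = amp_coh_fmap M W g \oc amp_coh_fmap L M f.
Proof.
apply: amp_coh_hom_ext => i x.
transitivity (qpi (@bound W i) (cycles_map g i (cycles_map f i x))).
  by rewrite amp_coh_homE; congr qpi; exact: val_inj.
by rewrite -(amp_coh_homE g) -(amp_coh_homE f).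
Qed.

Definition AH : kfunctor modL gr := KFunctor amp_coh_fmap1 amp_coh_fmapM.

End NComplexes.
End Graded.

(* Main.v *)
(** Every N-complex P is a quotient of the free N-complex on its underlying
    graded space, and the amplitude cohomology of a free N-complex vanishes by
    inspection. If P is projective, it is a retract of that free complex, so its
    amplitude cohomology vanishes too; hence amplitude cohomology kills every
    morphism that factors through a projective. *)

Require Import Defs.
From mathcomp Require Import all_boot all_order all_algebra.
From HB Require Import structures.
From mathcomp Require Import boolp zify.
(* [hom] would otherwise denote the one of [vector]. *)
Import Defs.

Set Implicit Arguments.
Unset Strict Implicit.
Unset Printing Implicit Defensive.

Import GRing.Theory.

Local Open Scope ring_scope.
Local Open Scope quotient_scope.

(** * Functors that kill an ideal factor through the quotient category *)

Section FunctorFactorization.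
Variables (k : fieldType) (C D : kcat k).

Lemma kfunctor_eq (fo : C -> D)
    (m m' : forall x y, {linear hom C x y -> hom D (fo x) (fo y)})
    m1 m1' mM mM' :
  (forall x y f, m x y f = m' x y f) ->
  @KFunctor k C D fo m m1 mM = @KFunctor k C D fo m' m1' mM'.
Proof.
move=> mm; have e : m = m'.
  apply: functional_extensionality_dep => x.
  apply: functional_extensionality_dep => y.
  by apply: linear_ext => f; exact: mm.
case: _ / e m1' mM' => m1' mM'.
by rewrite (Prop_irrelevance m1 m1') (Prop_irrelevance mM mM').
Qed.

Variables (I : kideal C) (F : kfunctor C D).
Hypothesis FI : forall x y (f : hom C x y), f \in I x y -> fmap F f = 0.

Definition lift_fun x y (u : hom (quot_cat I) x y) : hom D (F x) (F y) :=
  fmap F (repr (u : qhom I x y)).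

(** The chosen representative differs from [f] by an element of [I], which [F] kills. *)
Lemma lift_funE x y (f : hom C x y) : lift_fun (qcls I f) = fmap F f.
Proof.
apply/eqP; rewrite -subr_eq0 -linearB; apply/eqP/FI.
by apply/qpiP; exact: qpi_repr.
Qed.

Fact lift_fun_is_linear x y : linear (@lift_fun x y).
Proof.
move=> c u v; rewrite -(qcls_repr u) -(qcls_repr v).
by rewrite -[X in lift_fun X]linearP !lift_funE linearP.
Qed.
HB.instance Definition _ x y :=
  GRing.isLinear.Build k (hom (quot_cat I) x y) (hom D (F x) (F y)) _
    (@lift_fun x y) (@lift_fun_is_linear x y).

Definition lift_fmap x y :
  {linear hom (quot_cat I) x y -> hom D (F x) (F y)} := @lift_fun x y.

Fact lift_fmap1 x : lift_fmap x x (idm (x : quot_cat I)) = idm (F x).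
Proof. by rewrite -fmap1 -lift_funE. Qed.

Fact lift_fmapM x y z (g : hom (quot_cat I) y z) (f : hom (quot_cat I) x y) :
  lift_fmap x z (g \oc f) = lift_fmap y z g \oc lift_fmap x y f.
Proof.
rewrite /= -(qcls_repr g) -(qcls_repr f) qcompE !lift_funE; exact: fmapM.
Qed.

Definition lift_functor : kfunctor (quot_cat I) D :=
  KFunctor lift_fmap1 lift_fmapM.

Lemma lift_functorK : fcomp lift_functor (quot_functor I) = F.
Proof.
transitivity (KFunctor (@fmap1 _ _ _ F) (@fmapM _ _ _ F)); last by case: F.
by apply: kfunctor_eq => x y f; exact: lift_funE.
Qed.

End FunctorFactorization.

(** * Free N-complexes inside products of vector spaces *)

Section Product.
Variables (k : fieldType) (J : Type) (V : J -> lmodType k).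

Definition prodspace := forall j, V j.

HB.instance Definition _ := gen_eqMixin prodspace.
HB.instance Definition _ := gen_choiceMixin prodspace.

Definition prod_zero : prodspace := fun j => 0.
Definition prod_opp (f : prodspace) : prodspace := fun j => - f j.
Definition prod_add (f g : prodspace) : prodspace := fun j => f j + g j.
Definition prod_scale (c : k) (f : prodspace) : prodspace := fun j => c *: f j.

Lemma prodspace_ext (f g : prodspace) : (forall j, f j = g j) -> f = g.
Proof. exact: functional_extensionality_dep. Qed.

Fact prod_addA : associative prod_add.
Proof. by move=> f g h; apply: prodspace_ext => j; exact: addrA. Qed.
Fact prod_addC : commutative prod_add.
Proof. by move=> f g; apply: prodspace_ext => j; exact: addrC. Qed.
Fact prod_add0 : left_id prod_zero prod_add.
Proof. by move=> f; apply: prodspace_ext => j; exact: add0r. Qed.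
Fact prod_addN : left_inverse prod_zero prod_opp prod_add.
Proof. by move=> f; apply: prodspace_ext => j; exact: addNr. Qed.
HB.instance Definition _ := GRing.isZmodule.Build prodspace
  prod_addA prod_addC prod_add0 prod_addN.

Fact prod_scaleA a b f : prod_scale a (prod_scale b f) = prod_scale (a * b) f.
Proof. by apply: prodspace_ext => j; exact: scalerA. Qed.
Fact prod_scale1 : left_id 1 prod_scale.
Proof. by move=> f; apply: prodspace_ext => j; exact: scale1r. Qed.
Fact prod_scaleDr : right_distributive prod_scale +%R.
Proof. by move=> c f g; apply: prodspace_ext => j; exact: scalerDr. Qed.
Fact prod_scaleDl f : {morph prod_scale^~ f : a b / a + b}.
Proof. by move=> a b; apply: prodspace_ext => j; exact: scalerDl. Qed.
HB.instance Definition _ := GRing.Zmodule_isLmodule.Build k prodspace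
  prod_scaleA prod_scale1 prod_scaleDr prod_scaleDl.

End Product.

(* The free N-complex on [V] is, in degree [i], the sum of the [V j] with
   [i - N < j <= i]; it is realised inside the full product so that its
   differential becomes a truncation and no degree cast is needed. *)
Section FreeComplex.
Variables (k : fieldType) (N : nat) (V : grobj k).
Implicit Type phi : prodspace V.

Definition inwin (i j : int) : bool := (i - N%:Z < j) && (j <= i).

Definition window (i : int) : {pred prodspace V} := fun phi =>
  `[< forall j, ~~ inwin i j -> phi j = 0 >].

Fact window_submod i : subsemimod_closed (window i).
Proof.
split; [split|].
- exact/asboolP.
- move=> f g /asboolP f0 /asboolP g0; apply/asboolP => j ij.
  by rewrite [LHS](_ : _ = f j + g j) // f0 // g0 // addr0.
- move=> c f /asboolP f0; apply/asboolP => j ij.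
  by rewrite [LHS](_ : _ = c *: f j) // f0 // scaler0.
Qed.
HB.instance Definition _ i :=
  GRing.isSubmodClosed.Build k (prodspace V) (window i) (window_submod i).

Definition cut (i : int) phi : prodspace V :=
  fun j => if inwin i j then phi j else 0.

Fact cut_is_linear i : linear (cut i).
Proof.
move=> c f g; apply: prodspace_ext => j.
rewrite [RHS](_ : _ = c *: cut i f j + cut i g j) // /cut.
by case: ifP => // _; rewrite scaler0 addr0.
Qed.
HB.instance Definition _ i :=
  GRing.isLinear.Build k (prodspace V) (prodspace V) _ (cut i)
    (cut_is_linear i).

Lemma cut_window i phi : cut i phi \in window i.
Proof. by apply/asboolP => j /negbTE ij; rewrite /cut ij. Qed.

Definition free_obj : grobj k := fun i => subspace (window i).

Lemma free_obj0 i (x : free_obj i) j : ~~ inwin i j -> val x j = 0.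
Proof. by have /asboolP := valP x; apply. Qed.

Definition free_d i : {linear free_obj i -> free_obj (i + 1)} :=
  @sub_map k _ _ (window i) (window (i + 1)) (cut (i + 1))
    (fun x _ => cut_window (i + 1) x).

(** Each differential only raises the lower edge of the window; the upper edge removes nothing,
    since [x] has no entry above [i]. *)
Lemma dpow_freeE n i (x : free_obj i) j :
  val (dpow free_d n x) j = if i + n%:Z - N%:Z < j then val x j else 0.
Proof.
elim: n => [|n IHn] /=.
  case: ifPn => // ij; apply: free_obj0.
  by move: ij; rewrite /inwin; lia.
rewrite {1}/cut; rewrite IHn shiftE /inwin.
have [|le_ij] := boolP (j <= i); first by repeat (case: ifP => //= ?); lia.
have /= -> : val x j = 0 by apply: free_obj0; rewrite /inwin; lia.
by rewrite !if_same.
Qed.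

Fact free_dN i (x : free_obj i) : dpow free_d N x = 0.
Proof.
apply: val_inj; apply: prodspace_ext => j; rewrite dpow_freeE.
by case: ifP => // ij; apply: free_obj0; rewrite /inwin; lia.
Qed.

Definition free_nc : ncomplex k N := NComplex free_dN.

(** If [dpow a] kills [x], then [x] is supported on [i - N < j <= i - (N - a)]. The same family is
    thus an element of degree [i - (N - a)], and it is its own preimage: [N - a] differentials
    truncate only at [j <= i - N]. *)
Lemma free_exact a i (x : free_nc i) : (a <= N)%N ->
  dpow (ncd free_nc) a x = 0 -> x \in @im_pow k N free_nc (N - a) i.
Proof.
move=> leaN dx0.
have xE j : i + a%:Z - N%:Z < j -> val x j = 0.
  move=> ij; have := congr1 (fun y : free_nc _ => val y j) dx0.
  by rewrite dpow_freeE ij.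
have yP : val x \in window (i - (N - a)%N%:Z).
  apply/asboolP => j; rewrite /inwin => ij.
  have [/xE//|ij'] := boolP (i + a%:Z - N%:Z < j).
  by apply: free_obj0; rewrite /inwin; lia.
apply/asboolP; exists (Subspace yP); apply: val_inj.
apply: prodspace_ext => j.
(* A degree cast leaves the underlying family unchanged. *)
have -> l m (e : l = m) (z : free_nc l) :
    val (ecast m (free_nc m) e z) j = val z j by case: _ / e.
rewrite dpow_freeE /=; case: ifPn => // ij.
by rewrite free_obj0 // /inwin; lia.
Qed.

End FreeComplex.

(** * The canonical epimorphism from a free N-complex *)

Section FreeCover.
Variables (k : fieldType) (N : nat) (M : ncomplex k N).

(** Indexed by the target degree, so that the terms for all [n] can be summed in [M i]. *)
Definition push (n : nat) (i : int) (phi : prodspace M) : M i :=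
  ecast j (M j) (shiftB n i) (dpow (ncd M) n (phi (i - n%:Z))).

Fact push_is_linear n i : linear (push n i).
Proof. by move=> c f g; rewrite /push -ecast_linear -linearP. Qed.

Lemma push0 i phi : push 0 i phi = phi i.
Proof.
rewrite /push; move: (shiftB 0 i); rewrite /= subr0 => e.
by rewrite (Prop_irrelevance e (erefl i)).
Qed.

Lemma pushS n i phi : push n.+1 (i + 1) phi = ncd M i (push n i phi).
Proof.
(* Generalizing the two cast proofs lets the source degrees be identified. *)
rewrite /push; move: (shiftB n.+1 (i + 1)) (shiftB n i).
have -> : i + 1 - n.+1%:Z = i - n%:Z by lia.
move: (i - n%:Z) => j e e'; case: _ / e' e => e.
by rewrite (Prop_irrelevance e (erefl _)).
Qed.

Lemma pushN i phi : push N i phi = 0.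
Proof. by rewrite /push ncdN ecast0. Qed.

Lemma push_eq n i (phi psi : prodspace M) :
  phi (i - n%:Z) = psi (i - n%:Z) -> push n i phi = push n i psi.
Proof. by rewrite /push => ->. Qed.

Lemma push_eq0 n i (phi : prodspace M) : phi (i - n%:Z) = 0 -> push n i phi = 0.
Proof. by rewrite /push => ->; rewrite linear0 ecast0. Qed.

(** This is the counit of the free-forgetful adjunction: the entry at [i - n] stands for the
    [n]-fold differential of a generator. *)
Definition cover_fun i (x : free_nc N M i) : M i :=
  \sum_(n < N) push n i (val x).

Fact cover_fun_is_linear i : linear (@cover_fun i).
Proof.
move=> c x y; rewrite /cover_fun scaler_sumr -big_split /=.
by apply: eq_bigr => n _; rewrite -push_is_linear.
Qed.
HB.instance Definition _ i :=
  GRing.isLinear.Build k (free_nc N M i) (M i) _ (@cover_fun i)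
    (@cover_fun_is_linear i).

Definition cover_gr : grhom (free_nc N M) M := GrHom (fun i => @cover_fun i).

Fact cover_chain : cover_gr \in @is_chain k N (free_nc N M) M.
Proof.
apply/asboolP => i x; rewrite /= /cover_fun linear_sum /=.
transitivity (\sum_(n < N) push n (i + 1) (val x)).
  (* The sum reads only the entries at [i + 1 - n] with [n < N], all kept by the truncation. *)
  apply: eq_bigr => n _; apply: push_eq.
  by rewrite /= /cut ifT // /inwin; have := ltn_ord n; lia.
(* Add the term [n = N], zero as [N] differentials compose to zero, then drop [n = 0], zero as [x]
   has no entry at [i + 1]; the rest is the sum for [i] shifted by one. *)
transitivity (\sum_(n < N.+1) push n (i + 1) (val x)).
  by rewrite big_ord_recr /= pushN addr0.
rewrite big_ord_recl /=.
rewrite push0 free_obj0 ?add0r; last by rewrite /inwin; lia.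
by apply: eq_bigr => n _; rewrite -pushS.
Qed.

Definition cover : hom (modL k N) (free_nc N M) M := Subspace cover_chain.

(** The match on [eqP] supplies the proof of [i = j] along which [x] is transported. *)
Definition single i (x : M i) : prodspace M := fun j =>
  if @eqP _ i j is ReflectT e then ecast l (M l) e x else 0.

Lemma single_id i (x : M i) : single x i = x.
Proof.
by rewrite /single; case: eqP => // e; rewrite (Prop_irrelevance e erefl).
Qed.

Lemma single_neq i j (x : M i) : i != j -> single x j = 0.
Proof. by rewrite /single; case: eqP. Qed.

Lemma cover_surj : (0 < N)%N -> forall i (x : M i),
  exists y : free_nc N M i, val cover i y = x.
Proof.
move=> N_gt0 i x; have sP : single x \in @window k N M i.
  by apply/asboolP => j ij; apply: single_neq; move: ij; rewrite /inwin; lia.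
exists (Subspace sP); rewrite /= /cover_fun /=.
(* Only the term [n = 0] reads the entry at [i]; it exists because [N] is positive. *)
rewrite (bigD1 (Ordinal N_gt0)) //= push0 single_id big1 ?addr0 // => n n0.
apply: push_eq0; apply: single_neq.
by move: n0; rewrite -val_eqE /=; lia.
Qed.

Lemma cover_epi : (0 < N)%N -> epi cover.
Proof.
move=> N_gt0 W u v uv; apply: val_inj; apply: grhom_ext => i x.
have [y <-] := cover_surj N_gt0 x.
exact: (congr1 (fun h : nchom _ _ => val h i y) uv).
Qed.

End FreeCover.

Lemma im_pow_map (k : fieldType) N (M W : ncomplex k N) (f : nchom M W) n i x :
  x \in @im_pow k N M n i -> val f i x \in @im_pow k N W n i.
Proof.
move=> /asboolP[y <-]; apply/asboolP; exists (val f _ y).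
by rewrite -dpow_chain -ecast_grhom.
Qed.

(** A section [s] of the cover sends [x] to an element killed by [dpow a], hence to a boundary by
    [free_exact]; the cover carries that boundary back to [x]. *)
Lemma projective_exact (k : fieldType) N a (P : modL k N) i (x : P i) :
    (0 < N)%N -> (a <= N)%N -> projective P ->
  dpow (ncd P) a x = 0 -> x \in @im_pow k N P (N - a) i.
Proof.
move=> N_gt0 leaN projP dx0.
have [s sK] := projP _ _ (cover P) (idm P) (cover_epi N_gt0).
have <- : val (cover P) i (val s i x) = x.
  exact: (congr1 (fun h : nchom _ _ => val h i x) sK).
apply: im_pow_map; apply: free_exact => //.
by rewrite -dpow_chain dx0 linear0.
Qed.

(** Vanishing is phrased through the identity so that it can be composed with morphisms. *)
Lemma AH_projective (k : fieldType) N a (P : modL k N) :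
  (0 < N)%N -> (a <= N)%N -> projective P -> idm (AH k N a P) = 0.
Proof.
move=> N_gt0 leaN projP; apply: amp_coh_hom_ext => i x.
transitivity (qpi (@bound k N a P i) 0); last exact: linear0.
apply/qpiP; rewrite subr0; apply: projective_exact => //.
exact/eqP/(valP x).
Qed.

Theorem theorem3p4 (k : fieldType) (N : nat) (hN : (0 < N)%N)
    (a : nat) (ha : (1 <= a <= N - 1)%N) :
  exists F : kfunctor (stable_modL k N) (gr k),
    fcomp F (to_stable k N) = AH k N a.
Proof.
have leaN : (a <= N)%N by lia.
have AH_ideal x y (f : hom (modL k N) x y) :
    f \in proj_ideal (modL_additive k N) x y -> fmap (AH k N a) f = 0.
  move=> /asboolP[p [h [g [projp ->]]]].
  (* Insert the identity of the cohomology of [p], which is zero, between the two factors. *)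
  by rewrite fmapM -(comp1m (fmap _ g)) AH_projective // comp0m compm0.
by exists (lift_functor AH_ideal); exact: lift_functorK.
Qed.
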